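(* Let $0<p\le 1$ and let $X\in\mathbb{R}^{m\times n}$ with $\operatorname{rank}(X)=r\le d$. Then \[ \|X\|_{S_p}=\min_{U\in\mathbb{R}^{m\times d},\,V\in\mathbb{R}^{n\times d}:\,X=UV^{T}}\|U\|_{S_{2p}}\|V\|_{S_{2p}} =\min_{U\in\mathbb{R}^{m\times d},\,V\in\mathbb{R}^{n\times d}:\,X=UV^{T}}\left(\frac{\|U\|_{S_{2p}}^{2p}+\|V\|_{S_{2p}}^{2p}}{2}\right)^{1/p}, \] with both minima attained.
   Context: For $0<q<\infty$ and a real matrix $Y$ with singular values $\sigma_1(Y),\dots,\sigma_k(Y)$ ($k$ the smaller dimension of $Y$), the Schatten-$q$ (quasi-)norm is $\|Y\|_{S_q}=\left(\sum_{i=1}^{k}\sigma_i(Y)^q\right)^{1/q}$. *)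

(* Defs.v *)
From HB Require Import structures.
From mathcomp Require Import all_boot all_order all_algebra.
From mathcomp Require Import all_classical all_reals all_analysis.
Set Implicit Arguments. Unset Strict Implicit. Unset Printing Implicit Defensive.
Import Order.TTheory GRing.Theory Num.Theory.
Local Open Scope ring_scope.

Definition svd_diag {R : realType} (m n : nat) (s : seq R) : 'M[R]_(m, n) :=
  \matrix_(i < m, j < n) (if (i : nat) == (j : nat) then s`_i else 0).

Definition is_svd {R : realType} (m n : nat) (X : 'M[R]_(m, n)) (s : seq R) : Prop :=
  size s = minn m n /\ (forall x, x \in s -> 0 <= x) /\
  exists (P : 'M[R]_m) (Q : 'M[R]_n),
    P *m P^T = 1%:M /\ Q *m Q^T = 1%:M /\ X = P *m svd_diag m n s *m Q^T.

(* The singular values sigma_1(X), ..., sigma_k(X) (with multiplicity),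
   selected by classical choice among the lists satisfying [is_svd]
   (the multiset is unique; the order is irrelevant for the sums below). *)
Definition svals {R : realType} (m n : nat) (X : 'M[R]_(m, n)) : seq R :=
  xget [::] [set s | is_svd X s].

Definition schatten {R : realType} (q : R) (m n : nat) (X : 'M[R]_(m, n)) : R :=
  powR (\sum_(x <- svals X) powR x q) q^-1.

(* Main.v *)
(* The lower bound is Horn's inequality. For orthonormal families P, Q of k
   singular vectors of X = U V^T, the product of the corresponding singular
   values of X is det (P^T U V^T Q). By Cauchy-Binet and Cauchy-Schwarz its
   square is at most det (P^T U U^T P) * det (Q^T V V^T Q), and, again by
   Cauchy-Binet, each factor is at most the product of the k largest squared
   singular values of U, resp. V. Hence the p-th powers of the singular values
   of X are weakly log-majorized, so also weakly majorized, by those of the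
   products sigma_i(U) sigma_i(V); Cauchy-Schwarz and AM-GM conclude. Both
   minima are attained at U = P S^(1/2), V = Q S^(1/2) for a singular value
   decomposition X = P S Q^T with the zero singular values last. *)
Require Import Defs.
From HB Require Import structures.
From mathcomp Require Import all_boot all_order all_algebra.
From mathcomp Require Import all_classical all_reals all_analysis.
From mathcomp Require Import fingroup perm complex ring.
Set Implicit Arguments.
Unset Strict Implicit.
Import Order.TTheory GRing.Theory Num.Theory.
Local Open Scope ring_scope.

(** * Cauchy-Binet and determinant inequalities *)

Lemma cauchy_schwarz_sum (R : realFieldType) (I : Type) (s : seq I)
    (x y : I -> R) :
  (\sum_(i <- s) x i * y i) ^+ 2 <=
  (\sum_(i <- s) x i ^+ 2) * (\sum_(i <- s) y i ^+ 2).
Proof.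
rewrite -subr_ge0 -(@pmulr_rge0 _ 2)//.
(* Lagrange's identity: twice the gap is a double sum of squares. *)
suff -> : 2 * ((\sum_(i <- s) x i ^+ 2) * (\sum_(i <- s) y i ^+ 2) -
    (\sum_(i <- s) x i * y i) ^+ 2) =
    \sum_(i <- s) \sum_(j <- s) (x i * y j - x j * y i) ^+ 2.
  by apply: sumr_ge0 => i _; apply: sumr_ge0 => j _; exact: sqr_ge0.
transitivity (\sum_(i <- s) \sum_(j <- s) (x i ^+ 2 * y j ^+ 2) +
   \sum_(i <- s) \sum_(j <- s) (y i ^+ 2 * x j ^+ 2) -
   2 * \sum_(i <- s) \sum_(j <- s) ((x i * y i) * (x j * y j))).
  rewrite -!big_distrlr/=; ring.
rewrite mulr_sumr -big_split -sumrB/=; apply: eq_bigr => i _.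
rewrite mulr_sumr -big_split -sumrB/=; apply: eq_bigr => j _; ring.
Qed.

(* Cauchy-Binet, summed over all maps instead of all k-subsets: every subset is
   then counted once for each of its k! enumerations. *)
Lemma cauchy_binet (R : comRingType) (k n : nat)
    (A : 'M[R]_(k, n)) (B : 'M[R]_(n, k)) :
  \det (A *m B) *+ k`! =
  \sum_(f : {ffun 'I_k -> 'I_n}) \det (colsub f A) * \det (rowsub f B).
Proof.
transitivity (\sum_(s : {perm 'I_k}) \sum_(t : {perm 'I_k}) (-1) ^+ s * (-1) ^+ t *
    \prod_i (A *m B) (s i) (t i)).
  (* The factor [k!] becomes a sum over permutations [s]; the copy attached to [s] is the Leibniz
     sum with its factors re-enumerated by [s]. *)
  have -> : k`! = #|{perm 'I_k}| by rewrite card_Sn.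
  rewrite -sumr_const; apply: eq_bigr => s _.
  rewrite {1}/determinant (reindex_inj (mulgI s^-1%g))/=.
  apply: eq_bigr => t _; rewrite odd_permM odd_permV signr_addb; congr (_ * _).
  rewrite (reindex_inj (@perm_inj _ s))/=.
  by apply: eq_bigr => i _; rewrite permM permK.
under [RHS]eq_bigr => f _ do
  rewrite -det_tr {1}/determinant [X in _ * X]/determinant big_distrlr/=.
rewrite [RHS]exchange_big/=; apply: eq_bigr => s _.
rewrite [RHS]exchange_big/=; apply: eq_bigr => t _.
transitivity (\sum_(f : {ffun 'I_k -> 'I_n}) (-1) ^+ s * (-1) ^+ t *
   \prod_i (A (s i) (f i) * B (f i) (t i))).
  rewrite -mulr_sumr; congr (_ * _).
  under eq_bigr => i _ do rewrite mxE.
  by rewrite bigA_distr_bigA.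
apply: eq_bigr => f _; rewrite big_split/=.
rewrite mulrACA; congr (_ * _ * (_ * _)); by apply: eq_bigr => i _; rewrite !mxE.
Qed.

(** Cauchy-Binet expands all three determinants over the same maps [f], the two Gram determinants as
    sums of squared minors. Cauchy-Schwarz in [f] then applies, and the factors [k!] cancel. *)
Lemma det_mul_sqr_le (R : realFieldType) (k n : nat)
    (A : 'M[R]_(k, n)) (B : 'M[R]_(n, k)) :
  (\det (A *m B)) ^+ 2 <= \det (A *m A^T) * \det (B^T *m B).
Proof.
have kf0 : 0 < (k`!%:R : R) by rewrite ltr0n fact_gt0.
rewrite -(ler_pM2r (exprn_gt0 2 kf0)) -exprMn [X in _ <= _ * X]expr2 mulrACA.
rewrite !mulr_natr !cauchy_binet.
under [X in _ <= X * _]eq_bigr => f _ do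
  rewrite -trmx_mxsub det_tr -expr2.
under [X in _ <= _ * X]eq_bigr => f _ do
  rewrite -trmx_mxsub det_tr -expr2.
exact: cauchy_schwarz_sum.
Qed.

Lemma det_gram_ge0 (R : realFieldType) (k n : nat) (A : 'M[R]_(k, n)) :
  0 <= \det (A *m A^T).
Proof.
rewrite -(@pmulrn_lge0 _ _ k`!) ?fact_gt0// cauchy_binet.
apply: sumr_ge0 => f _.
by rewrite -trmx_mxsub det_tr -expr2 sqr_ge0.
Qed.

(** * Decreasing rearrangements and majorization *)

Lemma prod_sorted_le (R : numDomainType) (c : nat -> R) (J : seq nat) :
  (forall i, 0 <= c i) -> {homo c : i j / (i <= j)%N >-> j <= i} ->
  uniq J -> \prod_(j <- J) c j <= \prod_(i < size J) c i.
Proof.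
move=> c0 cmono uJ.
rewrite -(perm_big _ (permEl (perm_sort leq J)))/=.
have sJ : sorted ltn (sort leq J).
  by rewrite ltn_sorted_uniq_leq sort_uniq uJ sort_sorted//; exact: leq_total.
move: (sort leq J) (size_sort leq J) sJ => {uJ}K <- sK.
rewrite (big_nth 0%N) big_mkord; apply: ler_prod => i _; rewrite c0/=.
(* The entry at position [i] of a strictly increasing list of naturals is at least [i]. *)
apply: cmono.
case: i => i /= iK; elim: i iK => // i IH iK.
apply: leq_ltn_trans (IH (ltnW iK)) _.
by apply: (sorted_ltn_nth ltn_trans) => //; rewrite inE// ltnW.
Qed.

(* [h] permutes the indices of [s] and fixes the others, where both sequences
   take the default value. *)
Definition decreasing_rearrangement {R : realDomainType} (s t : seq R) : Prop :=
  [/\ perm_eq t s, (forall i, 0 <= t`_i),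
      {homo nth 0 t : i j / (i <= j)%N >-> j <= i} &
      exists g h : nat -> nat,
        [/\ cancel g h, cancel h g & forall i, t`_i = s`_(h i)]].

Lemma decreasing_rearrangement_exists (R : realDomainType) (s : seq R) :
  (forall x, x \in s -> 0 <= x) -> exists t, decreasing_rearrangement s t.
Proof.
move=> s0; pose ge_R := fun x y : R => y <= x.
have tot : total ge_R by move=> x y; exact: le_total.
have [I pI tE] := perm_iota_sort ge_R 0 s.
have szI : size I = size s by rewrite (perm_size pI) size_iota.
have uI : uniq I by rewrite (perm_uniq pI) iota_uniq.
have memI i : (i \in I) = (i < size s)%N by rewrite (perm_mem pI) mem_iota.
have szt : size (sort ge_R s) = size s by rewrite size_sort.
have t0 i : 0 <= (sort ge_R s)`_i.
  case: (ltnP i (size s)) => [lt_is|le_si]; last by rewrite nth_default ?szt.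
  by apply: s0; rewrite -(mem_sort ge_R) mem_nth ?szt.
have st : sorted ge_R (sort ge_R s) by exact: sort_sorted.
exists (sort ge_R s); split=> //.
- by rewrite perm_sort.
- move=> i j le_ij; case: (ltnP j (size s)) => [lt_js|le_sj]; last first.
    by rewrite [leLHS]nth_default ?szt.
  have tr : transitive ge_R by move=> x y z /[swap]; exact: le_trans.
  have rf : reflexive ge_R by move=> x; exact: lexx.
  by apply: (sorted_leq_nth tr rf 0 st); rewrite ?inE ?szt// (leq_ltn_trans le_ij).
(* [I] lists the indices of [s] in sorted order: [h] reads this list, [g] looks an index up in it,
   and both are the identity beyond [size s]. *)
exists (fun j => if (j < size s)%N then index j I else j).
exists (fun i => if (i < size s)%N then nth 0%N I i else i).
split=> i; case: (ltnP i (size s)) => [lt_is|le_si].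
- by rewrite -szI index_mem memI lt_is nth_index ?memI.
- by rewrite ltnNge le_si.
- by rewrite -memI mem_nth ?szI// index_uniq ?szI.
- by rewrite ltnNge le_si.
- by rewrite tE (nth_map 0%N) ?szI.
- by rewrite !nth_default ?szt.
Qed.

Lemma sum_antitone_ge0 (R : realDomainType) (a x : nat -> R) (n : nat) :
  (forall i, 0 <= a i) -> {homo a : i j / (i <= j)%N >-> j <= i} ->
  (forall k, (k <= n)%N -> 0 <= \sum_(i < k) x i) ->
  0 <= \sum_(i < n) a i * x i.
Proof.
case: n => [|n] a0 amono x0; first by rewrite big_ord0.
(* Summation by parts as an induction: since the partial sums of [x] are nonnegative, replacing the
   factor [a k] by the smaller [a k.+1] keeps the bound. *)
suff /(_ n (leqnn _)) H k : (k <= n)%N ->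
    a k * (\sum_(i < k.+1) x i) <= \sum_(i < k.+1) a i * x i.
  by apply: le_trans H; rewrite mulr_ge0 ?x0.
elim: k => [_|k IH kn]; first by rewrite !big_ord1.
rewrite big_ord_recr [leRHS]big_ord_recr/= mulrDr lerD2r.
apply: le_trans (IH (ltnW kn)); apply: ler_wpM2r; last exact: amono.
by apply: x0; rewrite ltnW.
Qed.

(* Weak log-majorization implies weak majorization: [c - a >= a * ln (c / a)],
   and the right-hand side is summed by parts. *)
Lemma log_majorization_sum (R : realType) (a c : nat -> R) (n : nat) :
  (forall i, 0 <= a i) -> (forall i, 0 <= c i) ->
  {homo a : i j / (i <= j)%N >-> j <= i} ->
  (forall k, (k <= n)%N -> \prod_(i < k) a i <= \prod_(i < k) c i) ->
  \sum_(i < n) a i <= \sum_(i < n) c i.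
Proof.
move=> a0 c0 amono; elim: n => [|n IH] leP; first by rewrite !big_ord0.
have [an0|an_neq0] := eqVneq (a n) 0.
  rewrite big_ord_recr [leRHS]big_ord_recr/= an0; apply: lerD => //.
  by apply: IH => k kn; apply: leP; rewrite (leq_trans kn).
have apos i : (i <= n)%N -> 0 < a i.
  by move=> /amono; apply: lt_le_trans; rewrite lt_def an_neq0 a0.
have cpos i : (i <= n)%N -> 0 < c i.
  move=> le_in; rewrite lt_def c0 andbT; apply/eqP => ci0.
  have : \prod_(i < n.+1) c i = 0.
    by apply/eqP/prodf_eq0; exists (Ordinal (le_in : (i < n.+1)%N)); rewrite //= ci0.
  move=> p0; have := leP _ (leqnn n.+1); rewrite p0 leNgt => /negP; apply.
  by apply: prodr_gt0 => j _; apply: apos; rewrite -ltnS.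
have ln_sum (f : nat -> R) k : (k <= n.+1)%N ->
    (forall i, (i <= n)%N -> 0 < f i) ->
    \sum_(i < k) ln (f i) = ln (\prod_(i < k) f i).
  move=> + f0; elim: k => [_|k IHk kn]; first by rewrite !big_ord0 ln1.
  rewrite !big_ord_recr/= lnM ?IHk ?(ltnW kn)// posrE ?f0//.
  by apply: prodr_gt0 => j _; rewrite f0// -ltnS (leq_trans (ltn_ord j))// ltnW.
rewrite -subr_ge0 -sumrB.
apply: (@le_trans _ _ (\sum_(i < n.+1) a i * (ln (c i) - ln (a i)))).
  apply: sum_antitone_ge0 (fun i => ln (c i) - ln (a i)) _ a0 amono _ => k kn.
  rewrite sumrB !ln_sum// subr_ge0 ler_ln ?leP// posrE;
  by apply: prodr_gt0 => j _; rewrite ?apos ?cpos// -ltnS (leq_trans (ltn_ord j)).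
apply: ler_sum => -[i /= i_n] _; rewrite ltnS in i_n.
have ai := apos i i_n; have ci := cpos i i_n.
rewrite -lnV ?posrE// -lnM ?posrE ?invr_gt0//.
(* Prepares [ln (1 + x) <= x] at [x = c i / a i - 1]. *)
have : c i / a i = 1 + (c i / a i - 1) by ring.
move=> ->.
apply: (@le_trans _ _ (a i * (c i / a i - 1))).
  rewrite ler_pM2l// le_ln1Dx// ltrBrDl subrr.
  by rewrite divr_gt0.
by rewrite mulrBr mulr1 mulrCA mulfV ?mulr1// gt_eqF.
Qed.

(** * Horn's inequality for products of singular values *)

Lemma det_colsub_noninjective (R : comRingType) (k n : nat) (A : 'M[R]_(k, n))
    (f : {ffun 'I_k -> 'I_n}) : ~~ injectiveb f -> \det (colsub f A) = 0.
Proof.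
move=> /injectivePn[i [j ij fij]]; rewrite -det_tr.
by apply: (determinant_alternate ij) => l; rewrite !mxE fij.
Qed.

Lemma svd_diag_gram (R : realType) (m n : nat) (s : seq R) :
  size s = minn m n ->
  svd_diag m n s *m (svd_diag m n s)^T = diag_mx (\row_i s`_i ^+ 2).
Proof.
move=> szs; apply/matrixP => i j; rewrite !mxE.
under eq_bigr => l _ do rewrite !mxE.
(* For [n <= i] row [i] of the diagonal matrix is zero, and so is the default value of [s] at
   [i]. *)
have [lt_in|le_ni] := ltnP i n; last first.
  rewrite (nth_default _ (_ : size s <= i)%N); last first.
    by rewrite szs geq_min le_ni orbT.
  rewrite expr0n mul0rn big1// => l _.
  by rewrite [_ == _]gtn_eqF ?mul0r// (leq_trans (ltn_ord l)).
rewrite (bigD1 (Ordinal lt_in))//= eqxx big1 ?addr0 => [|l li].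
  rewrite [_ == i :> nat]eq_sym; have [->|ij] := eqVneq i j.
    by rewrite eqxx mulr1n expr2.
  by rewrite ifN ?mulr0.
case: eqP => [il|_]; last by rewrite mul0r.
by case/eqP: li; apply: val_inj.
Qed.

(** With [A = W P], whose rows are orthonormal, the determinant is that of [A L A^T]. Cauchy-Binet
    makes it a sum of squared minors of [A] with weights that are products of [k] squared singular
    values, while the same squared minors without weights add up to [k!]. *)
Lemma det_compression_le (R : realType) (m n k : nat) (X : 'M[R]_(m, n))
    (s t : seq R) (W : 'M[R]_(k, m)) :
  is_svd X s -> decreasing_rearrangement s t -> W *m W^T = 1%:M ->
  \det (W *m X *m (W *m X)^T) <= \prod_(i < k) t`_i ^+ 2.
Proof.
move=> [szs [s0 [P [Q [PP [QQ ->]]]]]] [pts t0 tmono [g [h [gK hK th]]]] WW.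
have sE j : s`_j = t`_(g j) by rewrite th gK.
pose A := W *m P.
have AA : A *m A^T = 1%:M by rewrite trmx_mul mulmxA -(mulmxA W) PP mulmx1.
pose L : 'M[R]_m := diag_mx (\row_i s`_i ^+ 2).
have -> : W *m (P *m svd_diag m n s *m Q^T) *m
    (W *m (P *m svd_diag m n s *m Q^T))^T = A *m (L *m A^T).
  rewrite /L -(svd_diag_gram szs) /A !trmx_mul trmxK !mulmxA.
  congr (_ *m _ *m _ *m _).
  by rewrite -[RHS]mulmx1 -!mulmxA (mulmx1C QQ).
have kf0 : 0 < (k`!%:R : R) by rewrite ltr0n fact_gt0.
rewrite -(ler_pM2r kf0) mulr_natr cauchy_binet.
(* The right-hand [k!] is rewritten as [k! * det (A A^T)], so that both sides expand over the same
   [f]. *)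
rewrite -[leRHS]mulr1 -mulrA [k`!%:R * 1]mulrC mulr_natr.
rewrite -[X in X *+ _](det1 R k) -AA cauchy_binet mulr_sumr.
apply: ler_sum => f _.
have -> : rowsub f (L *m A^T) =
    diag_mx (\row_i s`_(f i) ^+ 2) *m (colsub f A)^T.
  by rewrite /L mul_diag_mx mul_diag_mx; apply/matrixP => i j; rewrite !mxE.
have -> : rowsub f A^T = (colsub f A)^T by apply/matrixP => i j; rewrite !mxE.
rewrite det_mulmx det_tr det_diag mulrCA -expr2.
(* Only injective [f] contribute; their indices [g (f i)] are distinct, so the weight is at most the
   product of the [k] largest squares. *)
have [/injectiveP fI|/det_colsub_noninjective ->] := boolP (injectiveb f); last first.
  by rewrite expr0n !mulr0.
apply: ler_wpM2r; first exact: sqr_ge0.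
under eq_bigr => i _ do rewrite mxE sE.
pose c i := t`_i ^+ 2.
have /(prod_sorted_le (c := c) (fun i => sqr_ge0 _)) :
    {homo c : i j / (i <= j)%N >-> j <= i}.
  by move=> i j ij; rewrite /c ler_sqr ?nnegrE// tmono.
move=> /(_ [seq g (f i) | i <- enum 'I_k]).
rewrite map_inj_uniq ?enum_uniq//; last first.
  by move=> i j /(can_inj gK)/val_inj/fI.
by rewrite big_map size_map size_enum_ord big_enum; apply.
Qed.

Lemma rowsub_orthonormal (R : comRingType) (k n : nat) (f : 'I_k -> 'I_n)
    (P : 'M[R]_n) : injective f -> P *m P^T = 1%:M ->
  rowsub f P *m (rowsub f P)^T = 1%:M.
Proof.
move=> fI PP; have -> : (rowsub f P)^T = colsub f P^T.
  by apply/matrixP => i j; rewrite !mxE.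
rewrite mulmx_colsub mul_rowsub_mx PP; apply/matrixP => i j.
by rewrite !mxE (inj_eq fI).
Qed.

Lemma horn_prod_le (R : realType) (m n d k : nat)
    (U : 'M[R]_(m, d)) (V : 'M[R]_(n, d)) (s a b s' a' b' : seq R) :
  is_svd (U *m V^T) s -> is_svd U a -> is_svd V b ->
  decreasing_rearrangement s s' -> decreasing_rearrangement a a' ->
  decreasing_rearrangement b b' ->
  \prod_(i < k) s'`_i <= \prod_(i < k) (a'`_i * b'`_i).
Proof.
move=> [szs [s0 [P [Q [PP [QQ UVE]]]]]] Ua Vb [ps s'0 _ [g [h [gK hK s'E]]]] ra rb.
have a'0 : forall i, 0 <= a'`_i by case: ra.
have b'0 : forall i, 0 <= b'`_i by case: rb.
(* If one of the first [k] values is zero, the left side vanishes. Otherwise each position [h i]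
   lies inside [s], so it indexes a left and a right singular vector. *)
have [/existsP[i /eqP s'i0]|] := boolP [exists i : 'I_k, s'`_i == 0].
  rewrite (bigD1 i)//= s'i0 mul0r; apply: prodr_ge0 => j _.
  exact: mulr_ge0.
rewrite negb_exists => /forallP s'neq0.
have hlt (i : 'I_k) : (h i < minn m n)%N.
  by rewrite ltnNge -szs; apply: contra (s'neq0 i) => ?; rewrite s'E nth_default.
pose f (i : 'I_k) : 'I_m := Ordinal (leq_trans (hlt i) (geq_minl _ _)).
pose f' (i : 'I_k) : 'I_n := Ordinal (leq_trans (hlt i) (geq_minr _ _)).
have fI : injective f by move=> i j [] /(can_inj hK)/val_inj.
have f'I : injective f' by move=> i j [] /(can_inj hK)/val_inj.
(* The rows of [W] and [W'] are the left and right singular vectors for the [k] largest singular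
   values of [U V^T]. *)
pose W := rowsub f P^T; pose W' := rowsub f' Q^T.
have WW : W *m W^T = 1%:M.
  by apply: rowsub_orthonormal => //; rewrite trmxK (mulmx1C PP).
have WW' : W' *m W'^T = 1%:M.
  by apply: rowsub_orthonormal => //; rewrite trmxK (mulmx1C QQ).
have detE : \det (W *m U *m (W' *m V)^T) = \prod_(i < k) s'`_i.
  have -> : W *m U *m (W' *m V)^T = diag_mx (\row_i s'`_i).
    rewrite trmx_mul !mulmxA -(mulmxA W) UVE /W.
    have -> : W'^T = colsub f' Q by apply/matrixP => i j; rewrite !mxE.
    rewrite mulmx_colsub !mul_rowsub_mx !mulmxA (mulmx1C PP) mul1mx -mulmxA.
    rewrite (mulmx1C QQ) mulmx1; apply/matrixP => i j; rewrite !mxE/= s'E.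
    by rewrite (inj_eq (can_inj hK)) val_eqE; case: eqP.
  by rewrite det_diag; apply: eq_bigr => i _; rewrite mxE.
rewrite -ler_sqr ?nnegrE; last 2 first.
- by apply: prodr_ge0 => i _.
- by apply: prodr_ge0 => i _; exact: mulr_ge0.
rewrite -detE; apply: le_trans (det_mul_sqr_le _ _) _.
rewrite trmxK big_split/= exprMn -!prodrXl.
apply: ler_pM.
- exact: det_gram_ge0.
- exact: det_gram_ge0.
- exact: det_compression_le Ua ra WW.
- exact: det_compression_le Vb rb WW'.
Qed.

(** * Existence of the singular value decomposition *)

(* Diagonalize over R[i]; the eigenvalues of a hermitian matrix are real. *)
Lemma symmetric_eigenvalue_neq0 (R : rcfType) (n : nat) (M : 'M[R]_n) :
  M^T = M -> M != 0 -> exists2 a, a != 0 & eigenvalue M a.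
Proof.
move=> symM M0; set f := real_complex R.
pose A : 'M[R[i]]_n := map_mx f M.
have herm : A \is hermsymmx.
  apply/is_hermitianmxP; rewrite expr0 scale1r; apply/matrixP => i j.
  by rewrite !mxE -{1}symM mxE; apply/eqP; rewrite eq_complex/= oppr0 !eqxx.
have /orthomx_spectralP AE := hermitian_normalmx herm.
have /mxOverP dreal := hermitian_spectral_diag_real herm.
have [i di0] : exists i, spectral_diag A 0 i != 0.
  apply/existsP; apply: contraNT M0; rewrite negb_exists => /forallP d0.
  have d0' : spectral_diag A = 0.
    by apply/rowP => i; rewrite [RHS]mxE; apply/eqP/negPn/d0.
  rewrite -(map_mx_eq0 f) -/A AE d0'.
  rewrite (_ : diag_mx 0 = 0) ?mulmx0 ?mul0mx//.
  by apply/matrixP => j k; rewrite !mxE mul0rn.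
have [a da] : exists a, f a = spectral_diag A 0 i.
  move: (dreal 0 i); case: (spectral_diag A 0 i) => x y.
  by rewrite complex_real => /eqP/= ->; exists x.
exists a; first by move: di0; rewrite -da; apply: contraNneq => ->.
suff ev : eigenvalue A (f a).
  rewrite eigenvalue_root_char -(fmorph_root f) map_char_poly.
  by rewrite -eigenvalue_root_char; exact: ev.
rewrite da; apply/eigenvalueP.
set S := spectralmx A in AE *.
exists (row i S).
  rewrite -row_mul {1}AE !mulmxA mulmxV ?spectral_unit// mul1mx.
  by rewrite row_mul row_diag_mx -scalemxAl -rowE.
apply/negP => /eqP r0; have := spectral_unit A.
rewrite unitmxE -/S (_ : \det S = 0) ?unitr0//.
rewrite (expand_det_row S i); apply: big1 => j _.
by move/rowP: r0 => /(_ j); rewrite !mxE => ->; rewrite mul0r.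
Qed.

(** Completes a unit vector to an orthogonal matrix. The reflection along [w = u - e] exchanges [e]
    and [u]; here [c] is the squared length of [w], which is nonzero unless [u = e], where the
    identity serves. *)
Lemma householder (R : realFieldType) (n : nat) (u : 'cV[R]_n.+1) :
  u^T *m u = 1%:M ->
  exists P : 'M[R]_n.+1, P *m P^T = 1%:M /\ col 0 P = u.
Proof.
move=> uu; pose e : 'cV[R]_n.+1 := delta_mx 0 0.
have ee : e^T *m e = 1%:M.
  by apply/matrixP => i j; rewrite !ord1 trmx_delta mul_delta_mx !mxE.
have [->|ue] := eqVneq u e.
  by exists 1%:M; rewrite trmx1 mulmx1 colE mul1mx.
pose w := u - e; pose x := u 0 0.
have uex : u^T *m e = x%:M.
  by rewrite -colE; apply/matrixP => i j; rewrite !ord1 !mxE mulr1n.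
have eux : e^T *m u = x%:M by rewrite -[LHS]trmxK trmx_mul trmxK uex tr_scalar_mx.
have wT : w^T = u^T - e^T by rewrite /w linearB.
have wwE : w^T *m w = (2 - 2 * x)%:M.
  rewrite wT /w mulmxBl !mulmxBr uu ee uex eux.
  by rewrite -!raddfB/=; congr (_%:M); ring.
have weE : w^T *m e = (x - 1)%:M.
  by rewrite wT mulmxBl uex ee -raddfB.
pose c := 2 - 2 * x.
have c0 : c != 0.
  apply: contra ue => /eqP c0; rewrite -subr_eq0; apply/eqP/colP => i.
  have /matrixP/(_ 0 0) : w^T *m w = 0 by rewrite wwE -/c c0 raddf0.
  rewrite !mxE => /eqP; rewrite psumr_eq0; last first.
    by move=> j _; rewrite !mxE -expr2 sqr_ge0.
  move=> /allP/(_ i); rewrite mem_index_enum => /(_ isT).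
  by rewrite !mxE -expr2 sqrf_eq0 => /eqP.
pose P := 1%:M - (2 / c) *: (w *m w^T).
have PT : P^T = P by rewrite /P linearB linearZ/= trmx_mul trmxK trmx1.
exists P; split; last first.
  rewrite colE mulmxBl mul1mx -scalemxAl -mulmxA weE mul_mx_scalar scalerA.
  rewrite (_ : 2 / c * (x - 1) = -1); last by rewrite /c; field.
  by rewrite scaleN1r opprK addrC subrK.
rewrite PT /P mulmxBl mul1mx mulmxBr mulmx1 -!scalemxAl -!scalemxAr.
rewrite -mulmxA (mulmxA w^T) wwE mul_scalar_mx -scalemxAr !scalerA.
rewrite (_ : 2 / c * (2 / c * (2 - 2 * x)) = 2 / c + 2 / c); last first.
  by rewrite /c; field.
by rewrite scalerDl opprB addrK subrK.
Qed.

Lemma gram_eq0 (R : realFieldType) (m n : nat) (X : 'M[R]_(m, n)) :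
  X^T *m X = 0 -> X = 0.
Proof.
move=> X0; apply/matrixP => i j; move/matrixP/(_ j j): X0; rewrite !mxE => /eqP.
rewrite psumr_eq0 => [/allP/(_ i)|k _]; last by rewrite !mxE -expr2 sqr_ge0.
by rewrite mem_index_enum => /(_ isT); rewrite !mxE -expr2 sqrf_eq0 => /eqP.
Qed.

(** A nonzero eigenvalue [a] of [X^T X] with row eigenvector [w] is positive because
    [a |w|^2 = |X w^T|^2]. The singular value is [sqrt a], and [v], [u] are the normalized [w^T] and
    [X w^T]. *)
Lemma singular_pair (R : realType) (m n : nat) (X : 'M[R]_(m, n)) :
  X != 0 -> exists (c : R) (u : 'cV[R]_m) (v : 'cV[R]_n),
    [/\ 0 < c, u^T *m u = 1%:M, v^T *m v = 1%:M,
        X *m v = c *: u & X^T *m u = c *: v].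
Proof.
move=> X0; have [||a a0 /eigenvalueP[w wE w0]] :=
    @symmetric_eigenvalue_neq0 R n (X^T *m X).
- by rewrite trmx_mul trmxK.
- by apply: contra X0 => /eqP/gram_eq0 ->.
have ww0 : 0 < (w *m w^T) 0 0.
  rewrite lt_def; apply/andP; split.
    apply: contra w0 => /eqP ww; rewrite -(trmx_eq0) (@gram_eq0 _ _ _ w^T)//.
    by apply/matrixP => i j; rewrite trmxK !ord1 ww mxE.
  by rewrite mxE; apply: sumr_ge0 => i _; rewrite mxE -expr2 sqr_ge0.
set q := (w *m w^T) 0 0 in ww0.
have XwE : X^T *m (X *m w^T) = a *: w^T.
  by rewrite -[RHS]linearZ/= -wE !trmx_mul trmxK mulmxA.
have XwXw : (X *m w^T)^T *m (X *m w^T) = (a * q)%:M.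
  rewrite trmx_mul -mulmxA XwE trmxK -scalemxAr -scale_scalar_mx.
  by rewrite [w *m _]mx11_scalar.
have a_gt0 : 0 < a.
  rewrite lt_def a0/= -(pmulr_lge0 _ ww0).
  have -> : a * q = ((X *m w^T)^T *m (X *m w^T)) 0 0 by rewrite XwXw mxE mulr1n.
  by rewrite mxE; apply: sumr_ge0 => i _; rewrite mxE -expr2 sqr_ge0.
have sa0 : 0 < Num.sqrt a by rewrite sqrtr_gt0.
have sq0 : 0 < Num.sqrt q by rewrite sqrtr_gt0.
have saE : Num.sqrt a ^+ 2 = a by rewrite sqr_sqrtr// ltW.
have sqE : Num.sqrt q ^+ 2 = q by rewrite sqr_sqrtr// ltW.
pose b := Num.sqrt a; pose z := Num.sqrt q.
have b0 : b != 0 by rewrite gt_eqF.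
have z0 : z != 0 by rewrite gt_eqF.
exists b, ((b * z)^-1 *: (X *m w^T)), (z^-1 *: w^T); split=> //.
- rewrite [(_ *: _)^T]linearZ/= -scalemxAl -scalemxAr XwXw !scale_scalar_mx; congr (_%:M).
  by rewrite -saE -sqE -/b -/z; field; rewrite ?b0 ?z0.
- rewrite [(_ *: _)^T]linearZ/= trmxK -scalemxAl -scalemxAr [w *m _]mx11_scalar -/q.
  by rewrite !scale_scalar_mx; congr (_%:M); rewrite -sqE -/z; field; rewrite ?b0 ?z0.
- by rewrite -scalemxAr scalerA; congr (_ *: _); field; rewrite ?b0 ?z0.
- rewrite -scalemxAr XwE !scalerA; congr (_ *: _).
  by rewrite -saE -/b; field; rewrite ?b0 ?z0.
Qed.

Lemma svd_diag_cons (R : realType) (m n : nat) (c : R) (s : seq R) :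
  svd_diag m.+1 n.+1 (c :: s) =
  block_mx (c%:M : 'M[R]_1) 0 0 (svd_diag m n s) :> 'M[R]_(1 + m, 1 + n).
Proof.
apply/matrixP => i j; rewrite [LHS]mxE -(splitK i) -(splitK j).
case: (fintype.split i) => i'; case: (fintype.split j) => j'; rewrite /unsplit.
- by rewrite block_mxEul !ord1 mxE mulr1n.
- by rewrite block_mxEur !ord1 mxE.
- by rewrite block_mxEdl !ord1 mxE.
- by rewrite block_mxEdr mxE/= eqSS.
Qed.

(* Splitting off a nonzero singular value as long as X is nonzero puts the zero
   singular values last. *)
Lemma svd_exists (R : realType) (m n : nat) (X : 'M[R]_(m, n)) :
  exists s, is_svd X s /\ forall i, (\rank X <= i)%N -> s`_i = 0.
Proof.
have svd0 m' n' : exists s, is_svd (0 : 'M[R]_(m', n')) s /\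
    forall i, (\rank (0%R : 'M[R]_(m', n')) <= i)%N -> s`_i = 0.
  have z i : (nseq (minn m' n') (0 : R))`_i = 0 by rewrite nth_nseq if_same.
  exists (nseq (minn m' n') 0); split=> //; split; first by rewrite size_nseq.
  split; first by move=> x /nseqP[-> _].
  exists 1%:M, 1%:M; rewrite !trmx1 !mulmx1; split=> //; split=> //.
  rewrite mul1mx; apply/matrixP => i j.
  by rewrite !mxE; case: eqP.
elim: m n X => [|m IH] n X; first by rewrite (flatmx0 X).
have [->//|X0] := eqVneq X 0.
case: n X X0 => [|n] X X0; first by rewrite (thinmx0 X) eqxx in X0.
have [c [u [v [c0 /householder[P [PP Pu]] /householder[Q [QQ Qv]] Xv Xu]]]] :=
  singular_pair X0.
(* As [P] and [Q] have first columns [u] and [v], the first row and column of [Y] vanish outside the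
   corner entry [c]; the induction continues with the remaining block. *)
pose Y : 'M[R]_(1 + m, 1 + n) := P^T *m X *m Q.
have Ycol : col 0 Y = c *: delta_mx 0 0.
  rewrite !colE -mulmxA -colE Qv -mulmxA Xv -scalemxAr -Pu colE.
  by rewrite mulmxA (mulmx1C PP) mul1mx.
have Yrow : row 0 Y = c *: delta_mx 0 0.
  apply: trmx_inj; rewrite tr_row linearZ/= trmx_delta.
  rewrite /Y !trmx_mul trmxK colE -!mulmxA -colE Pu Xu -scalemxAr -Qv colE.
  by rewrite mulmxA (mulmx1C QQ) mul1mx.
have XE : X = P *m Y *m Q^T.
  by rewrite /Y !mulmxA PP mul1mx -mulmxA QQ mulmx1.
clearbody Y.
pose Y' : 'M[R]_(m, n) := drsubmx Y.
have Yc i : Y i 0 = c *+ (i == 0).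
  by move/colP/(_ i): Ycol; rewrite !mxE eqxx andbT mulr_natr.
have Yr j : Y 0 j = c *+ (j == 0).
  by move/rowP/(_ j): Yrow; rewrite !mxE eqxx mulr_natr.
have YE : Y = block_mx (c%:M : 'M[R]_1) 0 0 Y'.
  have l0 k : lshift k (0 : 'I_1) = 0 :> 'I_(1 + k) by exact: val_inj.
  rewrite -[LHS]submxK; congr block_mx; apply/matrixP => i j; rewrite ?ord1.
  - by rewrite !mxE !l0 Yc.
  - by rewrite !mxE l0 Yr.
  - by rewrite !mxE l0 Yc.
have unitP : P \in unitmx by have [] := mulmx1_unit PP.
have unitQ : Q^T \in unitmx by have [] := mulmx1_unit QQ.
(* The rank drops by exactly one, matching the shift of positions in [c :: s]. *)
have rankX : \rank X = (\rank Y').+1.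
  rewrite XE mxrankMfree ?row_free_unit// eqmxMfull ?row_full_unit// YE.
  transitivity (\rank (c%:M : 'M[R]_1) + \rank Y')%N.
    exact (rank_diag_block_mx (c%:M : 'M[R]_1) Y').
  by rewrite mxrank_unit// unitmxE det_scalar1 unitfE gt_eqF.
have [s [[szs [s0 [P' [Q' [PP' [QQ' Y'E]]]]]] sr]] := IH _ Y'.
exists (c :: s); split; last first.
  by case=> [|i]; rewrite rankX// ltnS => /sr.
split; first by rewrite /= szs minnSS.
split; first by move=> x; rewrite inE => /predU1P[->|/s0//]; exact: ltW.
pose B : 'M[R]_(1 + m) := block_mx 1%:M 0 0 P'.
pose C : 'M[R]_(1 + n) := block_mx 1%:M 0 0 Q'.
have BB : B *m B^T = 1%:M.
  rewrite /B tr_block_mx !trmx0 trmx1 mulmx_block !mulmx0 !mul0mx mulmx1 !addr0 add0r.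
  by rewrite PP' -scalar_mx_block.
have CC : C *m C^T = 1%:M.
  rewrite /C tr_block_mx !trmx0 trmx1 mulmx_block !mulmx0 !mul0mx mulmx1 !addr0 add0r.
  by rewrite QQ' -scalar_mx_block.
have YBC : Y = B *m block_mx (c%:M : 'M[R]_1) 0 0 (svd_diag m n s) *m C^T.
  rewrite YE /B /C tr_block_mx !mulmx_block !trmx0 !mulmx0 !mul0mx !addr0 !add0r.
  by rewrite ?mul0mx ?trmx1 mul1mx mulmx1 ?mul0mx ?addr0 -Y'E.
exists (P *m B), (Q *m C); split.
  by rewrite trmx_mul mulmxA -(mulmxA P) BB mulmx1.
split; first by rewrite trmx_mul mulmxA -(mulmxA Q) CC mulmx1.
by rewrite XE YBC svd_diag_cons trmx_mul !mulmxA.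
Qed.

(** * Power sums of singular values *)

Lemma svalsP (R : realType) (m n : nat) (X : 'M[R]_(m, n)) : is_svd X (svals X).
Proof. by have [s [sX _]] := svd_exists X; exact: (xgetPex [::] (ex_intro _ s sX)). Qed.

(** Pads with zeros, so that lists of different lengths are compared over one index range. *)
Lemma sum_nth_ord (R : nmodType) (T : nmodType) (F : T -> R) (s : seq T) (N : nat) :
  F 0 = 0 -> (size s <= N)%N -> \sum_(x <- s) F x = \sum_(i < N) F s`_i.
Proof.
move=> F0 sN; rewrite (big_nth 0) big_mkord.
rewrite (big_ord_widen N (fun i => F s`_i))// big_mkcond/=.
by apply: eq_bigr => i _; case: ltnP => // ?; rewrite nth_default.
Qed.

Lemma powR_prod (R : realType) (q : R) (f : nat -> R) (k : nat) :
  (forall i, 0 <= f i) -> \prod_(i < k) f i `^ q = (\prod_(i < k) f i) `^ q.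
Proof.
move=> f0; elim: k => [|k IH]; first by rewrite !big_ord0 powR1.
by rewrite !big_ord_recr/= IH powRM// prodr_ge0.
Qed.

Lemma powR2M (R : realType) (p x : R) : 0 <= x -> x `^ (2 * p) = (x `^ p) ^+ 2.
Proof. by move=> x0; rewrite mulrC powRrM powR_mulrn// powR_ge0. Qed.

(** The [q]-th powers of Horn's product inequalities are the hypothesis of [log_majorization_sum].
    Arbitrary decompositions are allowed because independence of the choice in [svals] is deduced
    from this bound. *)
Lemma horn_sum_le (R : realType) (q : R) (m n d N : nat)
    (U : 'M[R]_(m, d)) (V : 'M[R]_(n, d)) (s a b a' b' : seq R) :
  0 < q -> is_svd (U *m V^T) s -> is_svd U a -> is_svd V b ->
  decreasing_rearrangement a a' -> decreasing_rearrangement b b' ->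
  (size s <= N)%N ->
  \sum_(x <- s) x `^ q <= \sum_(i < N) a'`_i `^ q * b'`_i `^ q.
Proof.
move=> q0 sX aU bV ra rb sN.
have [s' rs] : exists s', decreasing_rearrangement s s'.
  by apply: decreasing_rearrangement_exists; case: sX => _ [].
have [ps s'0 s'mono _] := rs.
have a'0 : forall i, 0 <= a'`_i by case: ra.
have b'0 : forall i, 0 <= b'`_i by case: rb.
rewrite -(perm_big _ ps)/= (@sum_nth_ord _ _ _ _ N) ?(perm_size ps)//; last first.
  by rewrite powR0// gt_eqF.
under [leRHS]eq_bigr => i _ do rewrite -powRM//.
apply: (log_majorization_sum (a := fun i => s'`_i `^ q)
                             (c := fun i => (a'`_i * b'`_i) `^ q)).
- by move=> i; exact: powR_ge0.
- by move=> i; exact: powR_ge0.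
- by move=> i j ij; rewrite ge0_ler_powR ?nnegrE ?(ltW q0)// s'mono.
- move=> k _; have ab0 i : 0 <= a'`_i * b'`_i by rewrite mulr_ge0.
  rewrite (powR_prod q k s'0) (powR_prod q k ab0).
  rewrite ge0_ler_powR ?nnegrE ?prodr_ge0 ?(ltW q0)//.
  exact: horn_prod_le sX aU bV rs ra rb.
Qed.

(* Horn's inequality with V = 1 replaces the uniqueness of singular values. *)
Lemma sum_svd_le (R : realType) (q : R) (m n : nat) (X : 'M[R]_(m, n)) (s t : seq R) :
  0 < q -> is_svd X s -> is_svd X t ->
  \sum_(x <- s) x `^ q <= \sum_(x <- t) x `^ q.
Proof.
move=> q0 sX tX.
have sX1 : is_svd (X *m (1%:M : 'M[R]_n)^T) s by rewrite trmx1 mulmx1.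
have svd1 : is_svd (1%:M : 'M[R]_n) (nseq n 1).
  split; first by rewrite size_nseq minnn.
  split; first by move=> x /nseqP[-> _].
  exists 1%:M, 1%:M; rewrite !trmx1 !mulmx1; split=> //; split=> //.
  rewrite mul1mx; apply/matrixP => i j; rewrite !mxE nth_nseq ltn_ord val_eqE.
  by case: eqP.
have [t' rt] : exists t', decreasing_rearrangement t t'.
  by apply: decreasing_rearrangement_exists; case: tX => _ [].
have [b' rb] : exists b', decreasing_rearrangement (nseq n (1 : R)) b'.
  by apply: decreasing_rearrangement_exists => x /nseqP[-> _].
set N := maxn (size s) (size t).
apply: (le_trans (horn_sum_le q0 sX1 tX svd1 rt rb (leq_maxl _ (size t)))).
have [pt _ _ _] := rt; have [_ b'0 _ [_ [h [_ _ b'E]]]] := rb.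
rewrite -(perm_big _ pt)/= (@sum_nth_ord _ _ _ _ N); last 2 first.
- by rewrite powR0// gt_eqF.
- by rewrite (perm_size pt) leq_maxr.
(* The singular values of the identity are 1, or 0 in the padding, so each weight is at most 1. *)
apply: ler_sum => i _; rewrite ler_piMr ?powR_ge0//.
apply: (@le_trans _ _ (1 `^ q)); last by rewrite powR1.
rewrite ge0_ler_powR ?nnegrE ?(ltW q0)//.
by rewrite b'E nth_nseq; case: ifP.
Qed.

Lemma sum_svalsE (R : realType) (q : R) (m n : nat) (X : 'M[R]_(m, n)) (s : seq R) :
  0 < q -> is_svd X s -> \sum_(x <- svals X) x `^ q = \sum_(x <- s) x `^ q.
Proof.
move=> q0 sX; apply/eqP; rewrite eq_le.
by rewrite !(sum_svd_le (X := X))//; exact: svalsP.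
Qed.

(** * The lower bounds and their attainment *)

Lemma schatten_holder (R : realType) (p : R) (m n d : nat)
    (U : 'M[R]_(m, d)) (V : 'M[R]_(n, d)) : 0 < p ->
  (\sum_(x <- svals (U *m V^T)) x `^ p) ^+ 2 <=
  (\sum_(x <- svals U) x `^ (2 * p)) * (\sum_(x <- svals V) x `^ (2 * p)).
Proof.
move=> p0; have p20 : 2 * p != 0 by rewrite gt_eqF// mulr_gt0.
have [a ra] : exists t, decreasing_rearrangement (svals U) t.
  by apply: decreasing_rearrangement_exists; case: (svalsP U) => _ [].
have [b rb] : exists t, decreasing_rearrangement (svals V) t.
  by apply: decreasing_rearrangement_exists; case: (svalsP V) => _ [].
have [pa a0 _ _] := ra; have [pb b0 _ _] := rb.
set N := maxn (size (svals (U *m V^T))) (maxn (size (svals U)) (size (svals V))).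
have := horn_sum_le p0 (svalsP _) (svalsP U) (svalsP V) ra rb (leq_maxl _ _ : _ <= N)%N.
rewrite -(perm_big _ pa) -[X in _ -> _ <= _ * X](perm_big _ pb)/=.
rewrite !(@sum_nth_ord _ _ (fun x => x `^ (2 * p)) _ N) ?powR0//; last 2 first.
- by rewrite (perm_size pb) !leq_max leqnn !orbT.
- by rewrite (perm_size pa) !leq_max leqnn !orbT.
move=> H; under [X in _ <= X * _]eq_bigr => i _ do rewrite powR2M//.
under [X in _ <= _ * X]eq_bigr => i _ do rewrite powR2M//.
(* Cauchy-Schwarz for the [p]-th powers of the entries of [a] and [b], whose squares are the [2p]-th
   powers. *)
apply: le_trans (cauchy_schwarz_sum _ _ _).
rewrite ler_sqr ?nnegrE//; apply: sumr_ge0 => i _; rewrite ?mulr_ge0 ?powR_ge0//.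
Qed.

Lemma schatten_factorization (R : realType) (p : R) (m n d : nat) (X : 'M[R]_(m, n)) :
  0 < p -> (\rank X <= d)%N ->
  exists (U : 'M[R]_(m, d)) (V : 'M[R]_(n, d)),
    [/\ X = U *m V^T,
        \sum_(x <- svals U) x `^ (2 * p) = \sum_(x <- svals X) x `^ p &
        \sum_(x <- svals V) x `^ (2 * p) = \sum_(x <- svals X) x `^ p].
Proof.
move=> p0 rXd; have [s [sX s_rank]] := svd_exists X.
have [szs [s0 [P [Q [PP [QQ XE]]]]]] := sX.
have s_ge0 i : 0 <= s`_i.
  by case: (ltnP i (size s)) => [/(mem_nth 0)/s0//|?]; rewrite nth_default.
have sd i : (d <= i)%N -> s`_i = 0.
  by move=> di; apply: s_rank; exact: leq_trans di.
(* The diagonal of [S^(1/2)] cut to a [k] by [d] matrix, used for [k = m] and [k = n]. Nothing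
   nonzero is cut: [s] vanishes from [d] on by the rank bound, and from [minn m n] on by default. *)
pose t k := mkseq (fun i => Num.sqrt s`_i) (minn k d).
have tE k i : (minn m n <= k)%N -> (t k)`_i = Num.sqrt s`_i.
  move=> mnk; have [ik|ki] := ltnP i (minn k d); first by rewrite nth_mkseq.
  rewrite nth_default ?size_mkseq//; move: ki; rewrite geq_min => /orP[ki|/sd ->].
    by rewrite nth_default ?sqrtr0// szs (leq_trans mnk).
  by rewrite sqrtr0.
have tm := tE m ^~ (geq_minl m n); have tn := tE n ^~ (geq_minr m n).
have svd_t k (O : 'M[R]_k) : O *m O^T = 1%:M ->
    is_svd (O *m svd_diag k d (t k)) (t k).
  move=> OO; split; first by rewrite size_mkseq.
  split; first by move=> x /mapP[i _ ->]; exact: sqrtr_ge0.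
  by exists O, 1%:M; rewrite !trmx1 !mulmx1.
have sum_t k : (minn m n <= k)%N ->
    \sum_(x <- t k) x `^ (2 * p) = \sum_(x <- svals X) x `^ p.
  move=> mnk; rewrite (sum_svalsE p0 sX).
  have pN0 : p != 0 by rewrite gt_eqF.
  rewrite !(@sum_nth_ord _ _ (fun x => x `^ _) _ (maxn (minn m n) (minn k d))).
  - apply: eq_bigr => i _; rewrite tE// powRrM powR_mulrn ?sqrtr_ge0//.
    by rewrite sqr_sqrtr.
  - by rewrite powR0.
  - by rewrite szs leq_maxl.
  - by rewrite powR0// mulf_neq0.
  - by rewrite size_mkseq leq_maxr.
have p20 : 0 < 2 * p by rewrite mulr_gt0.
exists (P *m svd_diag m d (t m)), (Q *m svd_diag n d (t n)); split.
- rewrite XE trmx_mul !mulmxA; congr (_ *m _); rewrite -mulmxA; congr (_ *m _).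
  apply/matrixP => i j; rewrite !mxE.
  under eq_bigr => l _ do rewrite !mxE tm tn.
  have [id|di] := ltnP i d; last first.
    rewrite big1; first by rewrite sd// if_same.
    by move=> l _; rewrite [_ == _]gtn_eqF ?mul0r// (leq_trans (ltn_ord l)).
  rewrite (bigD1 (Ordinal id))//= eqxx big1 ?addr0 => [|l li].
    rewrite [_ == i :> nat]eq_sym; case: eqP => [<-|_]; last by rewrite mulr0.
    by rewrite -expr2 sqr_sqrtr.
  case: eqP => [il|_]; last by rewrite mul0r.
  by case/eqP: li; apply: val_inj.
- by rewrite (sum_svalsE p20 (svd_t _ _ PP)) sum_t// geq_minl.
- by rewrite (sum_svalsE p20 (svd_t _ _ QQ)) sum_t// geq_minr.
Qed.

Unset Implicit Arguments.
Set Strict Implicit.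

Theorem theorem2 (R : realType) (p : R) (m n d r : nat) (X : 'M[R]_(m, n)) :
  0 < p -> p <= 1 -> \rank X = r -> (r <= d)%N ->
  ((exists (U : 'M[R]_(m, d)) (V : 'M[R]_(n, d)),
       X = U *m V^T /\ schatten p X = schatten (2 * p) U * schatten (2 * p) V)
   /\ (forall (U : 'M[R]_(m, d)) (V : 'M[R]_(n, d)),
       X = U *m V^T -> schatten p X <= schatten (2 * p) U * schatten (2 * p) V))
  /\
  ((exists (U : 'M[R]_(m, d)) (V : 'M[R]_(n, d)),
       X = U *m V^T /\
       schatten p X = powR ((powR (schatten (2 * p) U) (2 * p)
                             + powR (schatten (2 * p) V) (2 * p)) / 2) p^-1)
   /\ (forall (U : 'M[R]_(m, d)) (V : 'M[R]_(n, d)),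
       X = U *m V^T ->
       schatten p X <= powR ((powR (schatten (2 * p) U) (2 * p)
                              + powR (schatten (2 * p) V) (2 * p)) / 2) p^-1)).
Proof.
move=> p0 _ rX rd; rewrite -rX in rd.
pose S (q : R) (k l : nat) (Y : 'M[R]_(k, l)) := \sum_(x <- svals Y) x `^ q.
have S0 q k l (Y : 'M[R]_(k, l)) : 0 <= S q k l Y.
  by apply: sumr_ge0 => x _; exact: powR_ge0.
have p20 : 0 < 2 * p by rewrite mulr_gt0.
have normE q k l (Y : 'M[R]_(k, l)) : schatten q Y = S q k l Y `^ q^-1 by [].
have powE k l (Y : 'M[R]_(k, l)) : schatten (2 * p) Y `^ (2 * p) = S (2 * p) k l Y.
  by rewrite normE -powRrM mulVf ?powRr1// gt_eqF.
have prodE (U : 'M[R]_(m, d)) (V : 'M[R]_(n, d)) :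
    schatten (2 * p) U * schatten (2 * p) V =
    (S (2 * p) m d U * S (2 * p) n d V) `^ (2 * p)^-1 by rewrite !normE powRM.
(* Brings both sides of the product bound under the exponent [1 / (2p)], reducing it to
   [schatten_holder]. *)
have sqrE (x : R) : 0 <= x -> x `^ p^-1 = (x ^+ 2) `^ (2 * p)^-1.
  move=> x0; rewrite -powR_mulrn// -powRrM; congr (_ `^ _).
  by field; rewrite gt_eqF.
have [U [V [XE SU SV]]] := schatten_factorization p0 rd.
split; split.
- by exists U, V; rewrite prodE /S SU SV normE sqrE ?expr2.
- move=> U' V' X'E; rewrite prodE normE sqrE//.
  rewrite ge0_ler_powR ?nnegrE ?invr_ge0 ?(ltW p20) ?sqr_ge0 ?mulr_ge0//.
  by rewrite /S X'E; exact: schatten_holder.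
(* Both power sums equal that of [X], so their mean does too. *)
- exists U, V; split=> //; rewrite !powE /S SU SV normE; congr (_ `^ _).
  by rewrite /S; field.
- move=> U' V' X'E; rewrite !powE normE.
  have A0 := S0 (2 * p) m d U'; have B0 := S0 (2 * p) n d V'.
  rewrite ge0_ler_powR ?nnegrE ?invr_ge0 ?(ltW p0) ?divr_ge0 ?addr_ge0//.
  (* After squaring, [schatten_holder] bounds the left side by [A * B], and AM-GM remains, whose gap
     is the square of [(A - B) / 2]. *)
  rewrite -ler_sqr ?nnegrE ?divr_ge0 ?addr_ge0//.
  have := schatten_holder U' V' p0; rewrite -X'E -!/(S _ _ _ _) => /le_trans; apply.
  rewrite -subr_ge0.
  set A := S _ _ _ U'; set B := S _ _ _ V'.
  have -> : ((A + B) / 2) ^+ 2 - A * B = ((A - B) / 2) ^+ 2 by field.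
  exact: sqr_ge0.
Qed.
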